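(* Let $M_h=\mathrm{Model}[V_h,A_h,S_h]$ be a full order model (FOM) with quantity of interest $f_h=S_h\circ A_h\colon\mathcal{P}\to Q_{\Delta t}([0,T])$, let $\varepsilon>0$, and let $\mathrm{RomGen}_{\mathrm{RB}}$ and $\mathrm{RomGen}_{\mathrm{ML}}$ be $\varepsilon$-accurate ROM generators, the latter supporting the routine prolong. Let $M_{\mathrm{adapt}}=\mathrm{AdaptiveModel}[\mathrm{RomGen}_{\mathrm{RB}},\mathrm{RomGen}_{\mathrm{ML}},\varepsilon]$ be the adaptive model defined in the context, built adaptively from the initially trivial ROMs and generators. Then the output returned by $M_{\mathrm{adapt}}.\mathrm{eval\_output}[\mu]$ satisfies $$\|f_h(\mu)-M_{\mathrm{adapt}}.\mathrm{eval\_output}[\mu]\|_{L^2([0,T])}\le\varepsilon\qquad\text{for all }\mu\in\mathcal{P}.$$ Since $M_{\mathrm{adapt}}$ has an internal state that changes with each call, this is meant for every call, with any input $\mu\in\mathcal{P}$ and after any finite sequence of previous calls to the routines of $M_{\mathrm{adapt}}$.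
   Context: **Setting.** Let $\mathcal{P}\subseteq\mathbb{R}^p$ ($p\in\mathbb{N}$) be a parameter domain, $T>0$, and let $Q_{\Delta t}([0,T])\subset L^2([0,T])$ be a fixed finite-dimensional temporal approximation space of dimension $K$, induced by a temporal grid $0=t_1<\dots<t_K=T$. For a real Hilbert space $W$, let $Q_{\Delta t}(0,T;W)\subset L^2(0,T;W)$ be the corresponding space of $W$-valued trajectories. **State-based model.** A state-based model $M_*=\mathrm{Model}[V_*,A_*,S_*]$ consists of a real Hilbert space $V_*$ (state space), a state-evaluation operator $A_*\colon\mathcal{P}\to Q_{\Delta t}(0,T;V_* )$ and an output operator $S_*\colon Q_{\Delta t}(0,T;V_* )\to Q_{\Delta t}([0,T])$. It provides the routines $M_*.\mathrm{eval\_state}[\mu]=u_*(\mu):=A_*(\mu)$ and $M_*.\mathrm{eval\_output}[\mu]=f_*(\mu):=S_*(A_*(\mu))$ for $\mu\in\mathcal{P}$. The FOM $M_h=\mathrm{Model}[V_h,A_h,S_h]$ is a fixed state-based model which serves as the reference; $u_h:=A_h$, $f_h:=S_h\circ A_h$. **Certified ROM.** A certified reduced order model $M_*=\mathrm{ROM}[V_*,A_*,S_*,E_*]$ approximating the FOM $M_h$ consists of a linear subspace $V_*\subset V_h$ and operators $A_*,S_*$ such that $\mathrm{Model}[V_*,A_*,S_*]$ is a state-based model, with $u_*(\mu)$ and $f_*(\mu)$ regarded as approximations of $u_h(\mu)$ and $f_h(\mu)$, together with an output-error estimation operator $E_*\colon Q_{\Delta t}(0,T;V_* )\times\mathcal{P}\to\mathbb{R}$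 such that $$\|f_h(\mu)-S_*(v_* )\|_{L^2([0,T])}\le E_*(v_*;\mu)\quad\text{for all }v_*\in Q_{\Delta t}(0,T;V_* ),\ \mu\in\mathcal{P}.$$ In addition to the routines of a state-based model it provides $M_*.\mathrm{est\_output}[\mu]:=E_*(u_*(\mu);\mu)$. In every case the error estimate is with respect to the FOM output $f_h$. **$\varepsilon$-accurate ROM generator.** Given a state-based model $M_*$ and $\varepsilon>0$, an $\varepsilon$-accurate ROM generator $G_\diamond=\mathrm{RomGen}_\diamond[M_*,\varepsilon]$ is a stateful object with a set of training parameters $\mathcal{P}_\diamond$, initially $\mathcal{P}_\diamond=\emptyset$, and the routines: - $G_\diamond.\mathrm{extend}[\mu]$ for $\mu\in\mathcal{P}$: replaces $\mathcal{P}_\diamond$ by $\mathcal{P}_\diamond\cup\{\mu\}$ and collects any additional data associated with $\mu$ (e.g. by evaluating $M_*$) required for precompute. - $G_\diamond.\mathrm{precompute}[\,]$: returns a certified ROM $M_\diamond=\mathrm{ROM}[V_\diamond,A_\diamond,S_\diamond,E_\diamond]$ (approximating the FOM $M_h$), based on the data collected so far, that is $\varepsilon$-accurate with respect to the training data, i.e. $M_\diamond.\mathrm{est\_output}[\mu]\le\varepsilon$ for all $\mu\in\mathcal{P}_\diamond$. - optionally, $G_\diamond.\mathrm{prolong}[\widetilde M_*]$: given an extended state-based model $\widetilde M_*=\mathrm{Model}[\widetilde V_*,\widetilde A_*,\widetilde S_*]$ with $\widetilde V_*\supset V_*$, returns a new $\varepsilon$-accurate ROM generator $\mathrm{RomGen}_\diamond[\widetilde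 M_*,\varepsilon]$ by prolonging all previously collected data onto $\widetilde V_*$. **Adaptive model.** $M_{\mathrm{adapt}}=\mathrm{AdaptiveModel}[\mathrm{RomGen}_{\mathrm{RB}},\mathrm{RomGen}_{\mathrm{ML}},\varepsilon]$ has internal state $(G_{\mathrm{RB}},M_{\mathrm{RB}},G_{\mathrm{ML}},M_{\mathrm{ML}})$, initialized by $G_{\mathrm{RB}}:=\mathrm{RomGen}_{\mathrm{RB}}[M_h,\varepsilon]$, $M_{\mathrm{RB}}\leftarrow G_{\mathrm{RB}}.\mathrm{precompute}[\,]$, $G_{\mathrm{ML}}:=\mathrm{RomGen}_{\mathrm{ML}}[M_{\mathrm{RB}},\varepsilon]$, $M_{\mathrm{ML}}\leftarrow G_{\mathrm{ML}}.\mathrm{precompute}[\,]$. It is assumed that the successive state spaces $V_{\mathrm{RB}}$ of the models returned by $G_{\mathrm{RB}}.\mathrm{precompute}[\,]$ are nested increasing, so that the calls to prolong below are meaningful. The call $M_{\mathrm{adapt}}.\mathrm{eval\_output}[\mu]$, $\mu\in\mathcal{P}$, executes: 1. If $M_{\mathrm{ML}}.\mathrm{est\_output}[\mu]\le\varepsilon$: return $M_{\mathrm{ML}}.\mathrm{eval\_output}[\mu]$. 2. Otherwise, if $M_{\mathrm{RB}}.\mathrm{est\_output}[\mu]\le\varepsilon$: call $G_{\mathrm{ML}}.\mathrm{extend}[\mu]$; optionally (this may or may not be done) set $M_{\mathrm{ML}}\leftarrow G_{\mathrm{ML}}.\mathrm{precompute}[\,]$; return $M_{\mathrm{RB}}.\mathrm{eval\_output}[\mu]$.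 3. Otherwise, perform in order: $G_{\mathrm{RB}}.\mathrm{extend}[\mu]$; $M_{\mathrm{RB}}\leftarrow G_{\mathrm{RB}}.\mathrm{precompute}[\,]$; $G_{\mathrm{ML}}\leftarrow G_{\mathrm{ML}}.\mathrm{prolong}[M_{\mathrm{RB}}]$; $G_{\mathrm{ML}}.\mathrm{extend}[\mu]$; $M_{\mathrm{ML}}\leftarrow G_{\mathrm{ML}}.\mathrm{precompute}[\,]$; then return $M_{\mathrm{RB}}.\mathrm{eval\_output}[\mu]$ (with the updated $M_{\mathrm{RB}}$). The routine $M_{\mathrm{adapt}}.\mathrm{eval\_state}[\mu]$ is defined analogously, with the same tests and updates but returning the corresponding state $M_{\mathrm{ML}}.\mathrm{eval\_state}[\mu]$ or $M_{\mathrm{RB}}.\mathrm{eval\_state}[\mu]$. *)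

(* Defs.v *)
From HB Require Import structures.
From mathcomp Require Import all_boot all_order all_algebra.
From mathcomp Require Import sesquilinear.
From mathcomp Require Import all_classical all_reals all_analysis.

Set Implicit Arguments.
Unset Strict Implicit.
Unset Printing Implicit Defensive.

Import Order.TTheory GRing.Theory Num.Theory.
Import numFieldNormedType.Exports.

Local Open Scope classical_set_scope.
Local Open Scope ring_scope.

HB.mixin Record CompleteNormedModule_isHilbert (R : realType) V
    of CompleteNormedModule R V := {
  inner : {dot V for @idfun R};
  inner_normE : forall u : V, inner u u = `|u| ^+ 2
}.

#[short(type="hilbertType")]
HB.structure Definition Hilbert (R : realType) :=
  {V of CompleteNormedModule R V & CompleteNormedModule_isHilbert R V}.

(* A closed linear subspace of a Hilbert space is a Hilbert space for the
   induced inner product.  All state spaces are realised as such subspaces of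
   one ambient Hilbert space, so that V `<=` W makes sense for two of them; an
   abstract Hilbert space is the full subspace of itself. *)
Record hilbert_subspace (R : realType) (H : hilbertType R) := HilbertSubspace {
  subspace_set :> set H;
  subspace_submod : submod_closed [in subspace_set];
  subspace_closed : closed subspace_set
}.

(* L2norm T f is the norm of f in L^2([0,T]). *)
Definition L2norm (R : realType) (T : R) (f : R -> R) : \bar R :=
  Lnorm (mrestr (@lebesgue_measure R) (measurable_itv `[0, T])) 2%:E
    (EFin \o f).

(* A K-dimensional subspace of L^2([0,T]), given by a basis of square
   integrable functions, together with the grid 0 = t_1 < ... < t_K = T. *)
Record temporal_space (R : realType) (T : R) (K : nat) := TemporalSpace {
  grid : nat -> R;
  grid_gt0 : (0 < K)%N;
  grid_first : grid 1 = 0;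
  grid_last : grid K = T;
  grid_lt : forall i j, (1 <= i)%N -> (i < j)%N -> (j <= K)%N ->
    grid i < grid j;
  basis : 'I_K -> R -> R;
  basis_L2 : forall k, basis k \in
    Lfun (mrestr (@lebesgue_measure R) (measurable_itv `[0, T])) 2%:E;
  basis_free : forall c : 'I_K -> R,
    L2norm T (fun t => \sum_k c k * basis k t) = 0%E -> forall k, c k = 0
}.

(* W-valued trajectories: the functions t |-> \sum_k basis k t *: w_k with all
   w_k in W.  By basis_free, every element of the approximation space has exactly
   one such representative, hence equality of trajectories is equality of the
   L^2 classes they represent. *)
Definition trajectory (R : realType) (T : R) (K : nat)
    (Q : temporal_space T K) (H : lmodType R) (W : set H) : set (R -> H) :=
  [set u | exists2 w : 'I_K -> H, (forall k, W (w k)) &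
    u = fun t => \sum_k basis Q k t *: w k].

Definition scalar_trajectory (R : realType) (T : R) (K : nat)
    (Q : temporal_space T K) : set (R -> R) :=
  @trajectory R T K Q R^o setT.

Definition trajectory_dist (R : realType) (T : R) (K : nat)
    (Q : temporal_space T K) (f g : scalar_trajectory Q) : \bar R :=
  L2norm T (fun t => set_val f t - set_val g t).

Section Models.
Variables (R : realType) (p : nat) (P : set 'rV[R]_p).
Variables (T : R) (K : nat) (Q : temporal_space T K) (H : hilbertType R).

Record model := Model {
  state_space : hilbert_subspace H;
  eval_state : P -> trajectory Q state_space;
  output_map : trajectory Q state_space -> scalar_trajectory Q
}.

Definition eval_output (M : model) (mu : P) : scalar_trajectory Q :=
  output_map (eval_state M mu).

Record certified_rom (Mh : model) := ROM {
  rom_model :> model;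
  rom_sub : state_space rom_model `<=` state_space Mh;
  error_estimate : trajectory Q (state_space rom_model) -> P -> R;
  rom_certified : forall v mu,
    (trajectory_dist (eval_output Mh mu) (output_map v)
      <= (error_estimate v mu)%:E)%E
}.

Definition est_output (Mh : model) (M : certified_rom Mh) (mu : P) : R :=
  error_estimate (eval_state M mu) mu.

(* generator G M is the type of the possible internal states of the stateful
   object RomGen[M, eps]; a routine modifying the object returns its new
   internal state. *)
Record rom_generator (Mh : model) (eps : R) := RomGenerator {
  generator : model -> Type;
  new_generator : forall M, generator M;
  training_set : forall M, generator M -> set P;
  extend : forall M, generator M -> P -> generator M;
  precompute : forall M, generator M -> certified_rom Mh;
  training_set_new : forall M, training_set (new_generator M) = set0;
  training_set_extend : forall M (g : generator M) mu,
    training_set (extend g mu) = training_set g `|` [set mu];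
  precompute_accurate : forall M (g : generator M) mu,
    training_set g mu -> est_output (precompute g) mu <= eps
}.

Record prolongable_generator (Mh : model) (eps : R) := ProlongableGenerator {
  prolongable_rom_generator :> rom_generator Mh eps;
  prolong : forall M M' : model, state_space M `<=` state_space M' ->
    generator prolongable_rom_generator M ->
    generator prolongable_rom_generator M';
  training_set_prolong : forall M M' (h : state_space M `<=` state_space M')
      (g : generator prolongable_rom_generator M),
    training_set (prolong h g) = training_set g
}.

Section AdaptiveModel.
Variables (Mh : model) (eps : R).
Variables (RB : rom_generator Mh eps) (ML : prolongable_generator Mh eps).

(* RomGen_RB[Mh, eps] after the calls extend[mu] for mu in mus, in order. *)
Definition trained_RB (mus : seq P) : generator RB Mh :=
  foldl (@extend _ _ RB Mh) (new_generator RB Mh) mus.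

Definition nested_RB := forall (mus : seq P) (mu : P),
  state_space (precompute (trained_RB mus)) `<=`
  state_space (precompute (trained_RB (rcons mus mu))).

(* The proof component is established at initialisation and maintained by every
   call; it is what makes the calls to prolong well typed. *)
Record adaptive_state := AdaptiveState {
  G_RB : generator RB Mh;
  M_RB : certified_rom Mh;
  G_ML : generator ML M_RB;
  M_ML : certified_rom Mh;
  M_RB_current : exists2 mus, G_RB = trained_RB mus & M_RB = precompute G_RB
}.

Definition adaptive_init : adaptive_state :=
  let G := new_generator RB Mh in
  let M := precompute G in
  let G' := new_generator ML M in
  @AdaptiveState G M G' (precompute G')
    (ex_intro2 _ _ [::] erefl erefl).

Lemma extend_current (s : adaptive_state) (mu : P) :
  exists2 mus, extend (G_RB s) mu = trained_RB mus &
    precompute (extend (G_RB s) mu) = precompute (extend (G_RB s) mu).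
Proof.
have [mus e _] := M_RB_current s.
by exists (rcons mus mu) => //; rewrite /trained_RB foldl_rcons e.
Qed.

Lemma extend_nested (nested : nested_RB) (s : adaptive_state) (mu : P) :
  state_space (M_RB s) `<=` state_space (precompute (extend (G_RB s) mu)).
Proof.
have [mus e ->] := M_RB_current s.
by rewrite e; have := nested mus mu; rewrite {2}/trained_RB foldl_rcons.
Qed.

Variable nested : nested_RB.

(* The tests and updates common to eval_output and eval_state: returns the ROM
   which answers the call, and the new internal state.  The flag retrain is the
   decision whether to perform the optional precompute of step 2. *)
Definition adaptive_call (s : adaptive_state) (mu : P) (retrain : bool) :
    certified_rom Mh * adaptive_state :=
  if est_output (M_ML s) mu <= eps then (M_ML s, s)
  else if est_output (M_RB s) mu <= eps then
    let G' := extend (G_ML s) mu in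
    let M' := if retrain then precompute G' else M_ML s in
    (M_RB s, @AdaptiveState (G_RB s) (M_RB s) G' M' (M_RB_current s))
  else
    let G := extend (G_RB s) mu in
    let M := precompute G in
    let G' := extend (prolong (@extend_nested nested s mu) (G_ML s)) mu in
    (M, @AdaptiveState G M G' (precompute G') (extend_current s mu)).

Definition adaptive_eval_output (s : adaptive_state) (mu : P) (retrain : bool) :
    scalar_trajectory Q * adaptive_state :=
  let: (M, s') := adaptive_call s mu retrain in (eval_output M mu, s').

Definition adaptive_eval_state (s : adaptive_state) (mu : P) (retrain : bool) :
    (R -> H) * adaptive_state :=
  let: (M, s') := adaptive_call s mu retrain in
  (set_val (eval_state M mu), s').

Inductive adaptive_routine :=
  | EvalOutput of P & bool
  | EvalState of P & bool.

Definition run_routine (s : adaptive_state) (c : adaptive_routine) :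
    adaptive_state :=
  match c with
  | EvalOutput mu retrain => (adaptive_eval_output s mu retrain).2
  | EvalState mu retrain => (adaptive_eval_state s mu retrain).2
  end.

Definition adaptive_after (calls : seq adaptive_routine) : adaptive_state :=
  foldl run_routine adaptive_init calls.

End AdaptiveModel.
End Models.

(* Main.v *)
Require Import Defs.
From mathcomp Require Import all_boot all_order all_algebra.
From mathcomp Require Import all_classical all_reals all_analysis.

(* Each call is answered by a ROM whose estimate at mu is at most eps: the first
   two branches test this, and in the third the ROM has just been precomputed
   with mu in its training set. The estimate bounds the error against the FOM,
   so nothing about the history of the internal state is needed. *)

Local Open Scope ring_scope.

Lemma precompute_extend_accurate (R : realType) (p : nat) (P : set 'rV[R]_p)
    (T : R) (K : nat) (Q : temporal_space T K) (H : hilbertType R)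
    (Mh : model P Q H) (eps : R) (RB : rom_generator Mh eps) (M : model P Q H)
    (g : generator RB M) (mu : P) :
  est_output (precompute (extend g mu)) mu <= eps.
Proof.
by apply: precompute_accurate; rewrite training_set_extend; right.
Qed.

Lemma adaptive_call_accurate {R : realType} {p : nat} {P : set 'rV[R]_p}
    {T : R} {K : nat} {Q : temporal_space T K} {H : hilbertType R}
    {Mh : model P Q H} {eps : R}
    {RB : rom_generator Mh eps} {ML : prolongable_generator Mh eps}
    (nested : nested_RB RB) (s : adaptive_state RB ML) (mu : P)
    (retrain : bool) :
  est_output (adaptive_call nested s mu retrain).1 mu <= eps.
Proof.
(* In the first two branches the test that selects the ROM is itself the goal; [retrain] affects
   only the new state, not the ROM that answers. *)
rewrite /adaptive_call; case: ifP => // _; case: ifP => // _.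
exact: precompute_extend_accurate.
Qed.

Theorem proposition2p7 (R : realType) (p : nat) (P : set 'rV[R]_p)
    (T : R) (T_gt0 : 0 < T) (K : nat) (Q : temporal_space T K)
    (H : hilbertType R) (Mh : model P Q H)
    (eps : R) (eps_gt0 : 0 < eps)
    (RB : rom_generator Mh eps) (ML : prolongable_generator Mh eps)
    (nested : nested_RB RB)
    (calls : seq (adaptive_routine P)) (mu : P) (retrain : bool) :
  (trajectory_dist (eval_output Mh mu)
     (adaptive_eval_output nested (adaptive_after ML nested calls)
        mu retrain).1 <= eps%:E)%E.
Proof.
rewrite /adaptive_eval_output.
set s := adaptive_after ML nested calls.
have := adaptive_call_accurate nested s mu retrain.
case: (adaptive_call nested s mu retrain) => M s' /= M_acc.
(* Certification holds for every trajectory in the ROM's state space; at [eval_state M mu] its bound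
   is, by definition, [est_output M mu], which [M_acc] controls. *)
by apply: Order.POrderTheory.le_trans (rom_certified _ _) _; rewrite lee_fin.
Qed.
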